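(* Let $K$ be a field of prime characteristic $p$ and let $L/K$ be a finite field extension. Then: 1. $(L_{dif})^{G(L/K)}=L^{G(L/K)}\cap L_{dif}=L^{G(L/K)}_{dif}$. 2. The homomorphism $\mathrm{res}_{L_{dif}}:G(L/K)\to G\big(L_{dif}/L^{G(L/K)}_{dif}\big)$, $g\mapsto g|_{L_{dif}}$, is an isomorphism. 3. The finite field extension $L_{dif}/L^{G(L/K)}_{dif}$ is a Galois field extension with Galois group $G\big(L_{dif}/L^{G(L/K)}_{dif}\big)$ isomorphic to the group $G(L/K)=G(L/L^{G(L/K)})$ via the isomorphism $\mathrm{res}_{L_{dif}}$. In particular, each automorphism of the field extension $L_{dif}/L^{G(L/K)}_{dif}$ can be uniquely lifted to an automorphism of the field extension $L/K$. 4. $[L_{dif}:L^{G(L/K)}_{dif}]=[L:L^{G(L/K)}]$. 5. $[L^{G(L/K)}:L^{G(L/K)}_{dif}]=[L:L_{dif}]$, $G(L/L_{dif})=\{e\}$ and $G\big(L^{G(L/K)}/L^{G(L/K)}_{dif}\big)=\{e\}$. 6. $L=L^{G(L/K)}\otimes_{L^{G(L/K)}_{dif}}L_{dif}$ and $[L:L^{G(L/K)}_{dif}]=[L^{G(L/K)}:L^{G(L/K)}_{dif}]\,[L_{dif}:L^{G(L/K)}_{dif}]$.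
   Context: For a finite field extension $L/K$: $G(L/K)=\mathrm{Aut}_{K\text{-alg}}(L)$, with identity element $e$, and $L^{G(L/K)}$ is its fixed field. $\mathcal{D}(L/K)=\bigcup_{i\ge0}\mathcal{D}_i\subseteq\mathrm{End}_K(L)$ is the algebra of $K$-linear differential operators on $L$, where $\mathcal{D}_0=L$ (acting by multiplication) and $\mathcal{D}_i=\{\delta\in\mathrm{End}_K(L)\mid\delta l-l\delta\in\mathcal{D}_{i-1}\text{ for all }l\in L\}$. $L_{dif}=\{l\in L\mid l\delta=\delta l\text{ for all }\delta\in\mathcal{D}(L/K)\}$ and $L^{G(L/K)}_{dif}:=L^{G(L/K)}\cap L_{dif}$. One has $g(L_{dif})=L_{dif}$ for all $g\in G(L/K)$, so restriction to $L_{dif}$ is defined, and $(L_{dif})^{G(L/K)}$ is the set of elements of $L_{dif}$ fixed by $G(L/K)$. For subfields $M,N\supseteq F$ of $L$, ''$L=M\otimes_F N$'' means that the multiplication map $M\otimes_F N\to L$ is an isomorphism. *)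

(* Defs.v *)
From HB Require Import structures.
From mathcomp Require Import all_boot all_order all_algebra all_field.
From mathcomp Require Import boolp freeg.

Set Implicit Arguments.
Unset Strict Implicit.
Unset Printing Implicit Defensive.
Import GRing.Theory.
Local Open Scope ring_scope.

Section Automorphisms.
Variables (K : fieldType) (M : fieldExtType K).

(* G(M/F) for F a subspace of M containing K.  An endomorphism of the finite  *)
(* extension M/K is bijective (AEnd_lker0), so no further condition is needed. *)
Structure autg (F : {vspace M}) :=
  Autg {autg_val :> 'AEnd(M); _ : (F <= fixedSpace autg_val)%VS}.

Section Group.
Variable F : {vspace M}.

HB.instance Definition _ := [isSub for @autg_val F].
HB.instance Definition _ := [Choice of autg F by <:].

Lemma autg_fix (g : autg F) x : x \in F -> g x = x.
Proof. by case: g => g /= /fixedSpacesP/[apply]. Qed.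

Lemma autg_eqP (g h : autg F) : g =1 h <-> g = h.
Proof. by split=> [e | -> //]; do 2!apply: val_inj => /=; apply/lfunP. Qed.

Fact autg1_subproof : (F <= fixedSpace \1%AF)%VS.
Proof. by apply/fixedSpacesP=> x _; rewrite id_lfunE. Qed.

Fact autgM_subproof (g h : autg F) : (F <= fixedSpace (comp_ahom g h))%VS.
Proof. by apply/fixedSpacesP=> x Fx; rewrite comp_lfunE !autg_fix. Qed.

Fact autgV_subproof (g : autg F) : (F <= fixedSpace (inv_ahom g))%VS.
Proof.
apply/fixedSpacesP=> x Fx; rewrite -{1}(autg_fix g Fx) /=.
by rewrite lker0_lfunK ?AEnd_lker0.
Qed.

Definition autg_one := Autg autg1_subproof.
(* g * h is g after h, the opposite of the order used in AEnd_FinGroup.        *)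
Definition autg_mul g h := Autg (autgM_subproof g h).
Definition autg_inv g := Autg (autgV_subproof g).

Fact autg_mulA : associative autg_mul.
Proof. by move=> f g h; apply/autg_eqP=> x; rewrite !comp_lfunE. Qed.

Fact autg_mul1 : left_id autg_one autg_mul.
Proof. by move=> g; apply/autg_eqP=> x; rewrite comp_lfunE id_lfunE. Qed.

Fact autg_1mul : right_id autg_one autg_mul.
Proof. by move=> g; apply/autg_eqP=> x; rewrite comp_lfunE id_lfunE. Qed.

Fact autg_mulV : left_inverse autg_one autg_inv autg_mul.
Proof.
move=> g; apply/autg_eqP=> x.
by rewrite comp_lfunE id_lfunE /= lker0_lfunK ?AEnd_lker0.
Qed.

Fact autg_Vmul : right_inverse autg_one autg_inv autg_mul.
Proof.
move=> g; apply/autg_eqP=> x.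
by rewrite comp_lfunE id_lfunE /= lker0_lfunVK ?AEnd_lker0.
Qed.

HB.instance Definition _ := isGroup.Build (autg F)
  autg_mulA autg_mul1 autg_1mul autg_mulV autg_Vmul.

End Group.

End Automorphisms.

Section Subextensions.
Variables (K : fieldType) (L : fieldExtType K).
Implicit Types (E F : {subfield L}).

(* The subfield F of E, seen inside the type of elements of E.                *)
Definition base_in E F : {vspace subvs_of E} := (linfun vsval @^-1: F)%VS.

Lemma mem_base_in E F (x : subvs_of E) : (x \in base_in E F) = (vsval x \in F).
Proof. by rewrite -memv_preim lfunE. Qed.

(* G(E/F) for K <= F <= E <= L; G(L/F) is autg F.                             *)
Definition sub_autg E F := autg (base_in E F).

(* Normality is spelled out as in normalFieldP, because the library's         *)
(* normalField and galois require the ambient extension L/K to be normal.     *)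
Definition galois_ext F E : Prop :=
  [/\ (F <= E)%VS, separable F E
    & forall a, a \in E ->
        exists2 r, all [in E] r & minPoly F a = \prod_(b <- r) ('X - b%:P)].

Lemma exists_subfield (S : L -> Prop) :
    S 1 -> (forall k x y, S x -> S y -> S (k *: x + y)) ->
    (forall x y, S x -> S y -> S (x * y)) ->
  exists E : {subfield L}, forall x, x \in E <-> S x.
Proof.
move=> S1 SD SM.
have S0 : S 0 by rewrite -(addNr 1) -scaleN1r; exact: SD.
pose P n := `[< exists2 U : {vspace L}, \dim U = n & forall x, x \in U -> S x >].
have exP : exists n, P n.
  exists 0%N; apply/asboolP; exists 0%VS; first by rewrite dimv0.
  by move=> x /[!memv0]/eqP->.
have ubP n : P n -> (n <= \dim {:L})%N.
  by case/asboolP=> U <- _; rewrite dimvS ?subvf.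
case: (ex_maxnP exP ubP) => _ /asboolP[U <- US] maxU.
have SU x : S x -> x \in U.
  move=> Sx; have /eqP-> : U == (U + <[x]>)%VS.
    rewrite -(geq_leqif (dimv_leqif_eq (addvSl U <[x]>))).
    apply: maxU; apply/asboolP; exists (U + <[x]>)%VS => // z.
    by case/memv_addP=> u /US Su [_ /vlineP[k ->] ->]; rewrite addrC; apply: SD.
  by rewrite memvE addvSr.
suffices Ua : is_aspace U by exists (ASpace Ua) => x; split=> [/US | /SU].
rewrite /is_aspace has_algid1 ?SU //=.
by apply/prodvP=> x y /US Sx /US Sy; apply/SU/SM.
Qed.

Fact fixed_subfield_subproof E : exists F : {subfield L}, forall x,
  x \in F <-> x \in E /\ forall g : autg (1%VS : {vspace L}), g x = x.
Proof.
apply: exists_subfield => [|k x y [Ex gx] [Ey gy]|x y [Ex gx] [Ey gy]].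
- by split=> [|g]; rewrite ?mem1v ?rmorph1.
- by split=> [|g]; rewrite ?memvD ?memvZ // linearP /= gx gy.
by split=> [|g]; rewrite ?memvM // rmorphM /= gx gy.
Qed.

(* E^{G(L/K)} *)
Definition fixed_subfield E : {subfield L} :=
  sval (cid (fixed_subfield_subproof E)).

Lemma fixed_subfieldP E x : x \in fixed_subfield E <->
  x \in E /\ forall g : autg (1%VS : {vspace L}), g x = x.
Proof. exact: (svalP (cid (fixed_subfield_subproof E))). Qed.

End Subextensions.

Section DifferentialOperators.
Variables (K : fieldType) (L : fieldExtType K).

Fixpoint diffop_le (i : nat) (d : 'End(L)) : Prop :=
  if i is j.+1 then
    forall l : L, diffop_le j ((d \o amull l) - (amull l \o d))%VF
  else exists l : L, d = amull l.

Definition diffop (d : 'End(L)) : Prop := exists i, diffop_le i d.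

Definition dif_elt (l : L) : Prop :=
  forall d, diffop d -> (amull l \o d = d \o amull l)%VF.

Lemma dif_eltP l : dif_elt l <-> forall d, diffop d -> forall x, d (l * x) = l * d x.
Proof.
split=> H d /H.
  by move=> /lfunP e x; move: (e x); rewrite !comp_lfunE !lfunE.
by move=> e; apply/lfunP=> x; rewrite !comp_lfunE !lfunE /= e.
Qed.

Fact dif_subfield_subproof :
  exists E : {subfield L}, forall x, x \in E <-> dif_elt x.
Proof.
apply: exists_subfield => [|k x y|x y]; rewrite !dif_eltP.
- by move=> d _ x; rewrite !mul1r.
- move=> Dx Dy d Dd z; rewrite !mulrDl -!scalerAl linearP /=.
  by rewrite (Dx d) ?(Dy d).
by move=> Dx Dy d Dd z; rewrite -!mulrA (Dx d) ?(Dy d).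
Qed.

Definition dif_subfield : {subfield L} := sval (cid dif_subfield_subproof).

Lemma dif_subfieldP x : x \in dif_subfield <-> dif_elt x.
Proof. exact: (svalP (cid dif_subfield_subproof)). Qed.

Definition inv_subfield : {subfield L} := fixed_subfield {:L}%AS.

Definition inv_dif_subfield : {subfield L} := (inv_subfield :&: dif_subfield)%AS.

Section Restriction.
Implicit Type g : autg (1%VS : {vspace L}).

Lemma diffop_le_conj g i d :
  diffop_le i d -> diffop_le i (g \o (d \o inv_ahom g))%VF.
Proof.
have gK : cancel g (inv_ahom g) by move=> x /=; rewrite lker0_lfunK ?AEnd_lker0.
have Kg : cancel (inv_ahom g) g by move=> x /=; rewrite lker0_lfunVK ?AEnd_lker0.
elim: i d => [|i IHi] d /= => [[l ->]|Dd l].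
  by exists (g l); apply/lfunP=> x; rewrite !comp_lfunE !lfunE /= rmorphM /= Kg.
have := IHi _ (Dd (inv_ahom g l)); congr (diffop_le i _).
apply/lfunP=> x; rewrite !(comp_lfunE, add_lfunE, opp_lfunE, lfunE) /=.
by rewrite linearB rmorphM /= Kg (rmorphM (inv_ahom g)).
Qed.

Lemma dif_subfield_stable g x : x \in dif_subfield -> g x \in dif_subfield.
Proof.
have gK : cancel g (inv_ahom g) by move=> y /=; rewrite lker0_lfunK ?AEnd_lker0.
have Kg : cancel (inv_ahom g) g by move=> y /=; rewrite lker0_lfunVK ?AEnd_lker0.
rewrite !dif_subfieldP !dif_eltP => Dx d [i Dd] y.
have Dd' := diffop_le_conj (autg_inv g) Dd.
have invK z : inv_ahom (autg_inv g) z = g z.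
  by rewrite -{1}(gK z) /= lker0_lfunK ?AEnd_lker0.
have /= := Dx _ (ex_intro _ i Dd') (inv_ahom g y).
rewrite !comp_lfunE !invK rmorphM /= !Kg => /(congr1 g).
by rewrite rmorphM /= !Kg.
Qed.

Lemma dif_vsprojK g (x : subvs_of dif_subfield) :
  vsval (vsproj dif_subfield (g (vsval x))) = g (vsval x).
Proof. by rewrite vsprojK // dif_subfield_stable // subvsP. Qed.

Fact res_dif_linear g :
  linear (fun x : subvs_of dif_subfield => vsproj dif_subfield (g (vsval x))).
Proof. by move=> k x y; rewrite !linearP. Qed.

Definition res_dif_lin g : 'End(subvs_of dif_subfield) :=
  let f := fun x : subvs_of dif_subfield => vsproj dif_subfield (g (vsval x)) in
  linfun (HB.pack_for {linear _ -> _} f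
    (GRing.isLinear.Build _ _ _ _ f (res_dif_linear g))).

Lemma res_dif_linE g x : vsval (res_dif_lin g x) = g (vsval x).
Proof. by rewrite lfunE /= dif_vsprojK. Qed.

Fact res_dif_ahom g : ahom_in {:subvs_of dif_subfield} (res_dif_lin g).
Proof.
apply/ahom_inP; split=> [x y _ _|]; apply: subvs_inj.
  by rewrite rmorphM /= !res_dif_linE !rmorphM.
by rewrite res_dif_linE !rmorph1.
Qed.

Fact res_dif_fix g :
  (base_in dif_subfield inv_dif_subfield <= fixedSpace (AHom (res_dif_ahom g)))%VS.
Proof.
apply/fixedSpacesP=> x; rewrite mem_base_in memv_cap => /andP[/fixed_subfieldP Gx _].
by apply: subvs_inj; rewrite res_dif_linE; apply: Gx.2.
Qed.

Definition res_dif g : sub_autg dif_subfield inv_dif_subfield :=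
  Autg (res_dif_fix g).

Lemma res_difE g x : vsval (res_dif g x) = g (vsval x).
Proof. exact: res_dif_linE. Qed.

End Restriction.
End DifferentialOperators.

Section TensorProduct.
Variables (K : fieldType) (L : fieldExtType K) (F M N : {subfield L}).
Local Notation free := {freeg (subvs_of M * subvs_of N)%type / int}.
Local Notation gen m n := ([freeg [:: (1, (m, n))]] : free).

(* M (x)_F N is the free abelian group on M x N modulo the subgroup generated  *)
(* by the relators below; it is meant for F <= M and F <= N, in which case     *)
(* vsproj merely retypes the products as elements of M and N.                  *)
Inductive tensor_relator : free -> Prop :=
| TensorAddl m1 m2 n :
    tensor_relator (gen (m1 + m2) n - (gen m1 n + gen m2 n))
| TensorAddr m n1 n2 :
    tensor_relator (gen m (n1 + n2) - (gen m n1 + gen m n2))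
| TensorScale (a : subvs_of F) m n :
    tensor_relator (gen (vsproj M (vsval a * vsval m)) n
                    - gen m (vsproj N (vsval a * vsval n))).

Definition tensor_rel : {pred free} := fun z =>
  `[< forall S : {pred free}, zmod_closed S ->
        (forall r, tensor_relator r -> r \in S) -> z \in S >].

Fact tensor_rel_zmod_closed : zmod_closed tensor_rel.
Proof.
split=> [|x y /asboolP Sx /asboolP Sy]; apply/asboolP=> S zS rS.
  by case: zS.
by apply: zS.2; [apply: Sx | apply: Sy].
Qed.

HB.instance Definition _ :=
  GRing.isZmodClosed.Build free tensor_rel tensor_rel_zmod_closed.

Definition tensor := Quotient.quot tensor_rel.
HB.instance Definition _ := GRing.Zmodule.on tensor.

Definition free_mul (z : free) : L :=
  \sum_(mn <- dom z) (vsval mn.1 * vsval mn.2) *~ coeff mn z.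

(* The map m (x) n |-> m * n; tensor_mul_pi shows it is well defined.            *)
Definition tensor_mul (t : tensor) : L := free_mul (repr t).

Let mulMN (mn : subvs_of M * subvs_of N) : zmodule L := vsval mn.1 * vsval mn.2.
Let lift : free -> zmodule L := @fglift int (zmodule L) _ mulMN.

Let lift_zmod_morphism : zmod_morphism lift.
Proof. exact: lift_is_additive. Qed.

HB.instance Definition _ :=
  GRing.isZmodMorphism.Build free (zmodule L) lift lift_zmod_morphism.

Let liftE c mn : lift [freeg [:: (c, mn)]] = mulMN mn *~ c.
Proof. exact: liftU. Qed.

Let free_mulE z : free_mul z = lift z.
Proof.
rewrite -[in RHS](freeg_sumE z) raddf_sum /free_mul.
by apply: eq_bigr => mn _; exact/esym/liftE.
Qed.

Fact free_mul_zmod_morphism : zmod_morphism free_mul.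
Proof. by move=> x y; rewrite !free_mulE raddfB. Qed.

HB.instance Definition _ :=
  GRing.isZmodMorphism.Build free L free_mul free_mul_zmod_morphism.

Lemma free_mulU m n : free_mul (gen m n) = vsval m * vsval n.
Proof. by rewrite free_mulE liftE mulr1z. Qed.

Definition pure_tensor m n : tensor := (\pi_tensor (gen m n))%qT.

Hypotheses (sFM : (F <= M)%VS) (sFN : (F <= N)%VS).

Lemma free_mul_rel z : z \in tensor_rel -> free_mul z = 0.
Proof.
have kerC : zmod_closed [pred z | free_mul z == 0].
  split=> [|x y]; rewrite !inE ?raddf0 // raddfB /= => /eqP-> /eqP->.
  by rewrite subrr.
move=> /asboolP/(_ _ kerC) zS; apply/eqP; apply: zS => r [m1 m2 n|m n1 n2|a m n].
- by rewrite inE raddfB raddfD /= !free_mulU /= mulrDl subrr.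
- by rewrite inE raddfB raddfD /= !free_mulU /= mulrDr subrr.
rewrite inE raddfB /= !free_mulU !vsprojK ?memvM ?subvsP //.
- by rewrite mulrCA mulrA subrr.
- exact: subvP sFN _ (subvsP a).
exact: subvP sFM _ (subvsP a).
Qed.

Lemma tensor_mul_pi z : tensor_mul (\pi_tensor z)%qT = free_mul z.
Proof.
apply/eqP; rewrite -subr_eq0 -raddfB /=; apply/eqP/free_mul_rel.
by rewrite Quotient.idealrBE reprK.
Qed.

Lemma tensor_mulU m n : tensor_mul (pure_tensor m n) = vsval m * vsval n.
Proof. by rewrite tensor_mul_pi free_mulU. Qed.

Lemma tensor_mulD : {morph tensor_mul : s t / s + t}.
Proof.
move=> s t; rewrite -[s]reprK -[t]reprK -(raddfD (\pi_tensor)%qT).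
by rewrite !tensor_mul_pi raddfD.
Qed.
End TensorProduct.

(* L = M (x)_F N *)
Definition is_tensor_product (K : fieldType) (L : fieldExtType K)
    (F M N : {subfield L}) : Prop :=
  [/\ (F <= M)%VS, (F <= N)%VS & bijective (@tensor_mul K L F M N)].

(* Main.v *)
(* L/Ldif is purely inseparable: a differential operator of order i commutes
   with every l^(p^i), and a separable l lies in K(l^(p^(i+1))), so Ldif
   contains every element separable over K.  (That Ldif equals the separable
   closure is never needed.)  Hence an automorphism of L/K is determined by its
   restriction to Ldif.

   By Artin's argument the minimal polynomial of x over the fixed field of G in
   a G-stable E containing x is the product of the X - b, for b in the orbit of
   x.  So L/LG and Ldif/LGdif are separable; write Ldif = LGdif(t).  Then every
   element of L is both separable and purely inseparable over LG(t), whence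
   L = LG(t).  The minimal polynomials of t over LG and over LGdif coincide:
   this gives the degrees and the tensor decomposition, and any automorphism of
   Ldif/LGdif maps t to some g t, hence is the restriction of g. *)

Require Import Defs.
From HB Require Import structures.
From mathcomp Require Import all_boot all_order all_algebra all_field.
From mathcomp Require Import boolp freeg.

Set Implicit Arguments.
Unset Strict Implicit.
Unset Printing Implicit Defensive.
Import GRing.Theory.
Local Open Scope ring_scope.

(** [P] is an arbitrary proposition. A duplicate-free list inside [P] has bounded length because [q]
    has finitely many roots, and one of maximal length exhausts [P]. *)
Lemma finite_roots_subset (R : idomainType) (q : {poly R}) (P : R -> Prop) :
    q != 0 -> (forall x, P x -> root q x) ->
  exists2 r : seq R, uniq r & forall x, x \in r <-> P x.
Proof.
move=> nz_q Pq.
pose Q n := `[< exists r : seq R,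
  [/\ size r = n, uniq r & forall x, x \in r -> P x] >].
have exQ : exists n, Q n by exists 0%N; apply/asboolP; exists [::].
have ubQ n : Q n -> (n <= size q)%N.
  case/asboolP=> r [<- Ur rP]; apply/ltnW/max_poly_roots => //.
  by apply/allP=> x /rP/Pq.
case: (ex_maxnP exQ ubQ) => _ /asboolP[r [<- Ur rP]] max_r.
exists r => // x; split=> [/rP // | Px]; apply/negPn/negP=> r'x.
suffices /max_r : Q (size (x :: r)) by rewrite ltnn.
apply/asboolP; exists (x :: r); split=> //=; first by rewrite r'x.
by move=> y; rewrite inE => /predU1P[-> // | /rP].
Qed.

(** * Differential operators and p-power exponents *)

Section DiffOp.
Variables (K : fieldType) (L : fieldExtType K) (p : nat).
Hypothesis charLp : p \in [pchar L].

(** Induction on the order: for a = l^(p^i) the commutator f = [d, a] commutes with a, so [d, a^p] =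
    p a^(p-1) f = 0. *)
Lemma diffop_commute_expp i (d : 'End(L)) l x :
  diffop_le i d -> d (l ^+ (p ^ i) * x) = l ^+ (p ^ i) * d x.
Proof.
elim: i d x => [|i IHi] d x /= => [[k ->]|Dd].
  by rewrite !lfunE /= mulrCA.
set a := l ^+ (p ^ i); pose f x := d (a * x) - a * d x.
pose e x := d (l * x) - l * d x.
have ea y : e (a * y) = a * e y.
  have := IHi _ y (Dd l); rewrite -/a.
  by rewrite !(add_lfunE, opp_lfunE, comp_lfunE, lfunE).
(* [[d, a], l] = [[d, l], a] because a and l commute. *)
have fl y : f (l * y) = l * f y.
  have := ea y; rewrite /e mulrBr => /(canRL (subrK _)) E.
  rewrite /f [a * (l * y)]mulrCA E mulrBr (mulrCA l a (d y)).
  by rewrite addrAC [X in X + _]addrAC subrr add0r addrC.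
have fa y : f (a * y) = a * f y.
  rewrite /a; elim: (p ^ i)%N => [|n IHn]; first by rewrite !mul1r.
  by rewrite exprS -!mulrA fl IHn.
have da n y : d (a ^+ n.+1 * y) = a ^+ n.+1 * d y + (a ^+ n * f y) *+ n.+1.
  elim: n y => [|n IHn] y; first by rewrite expr1 mul1r addrC subrK.
  rewrite exprSr -mulrA IHn fa.
  have -> : d (a * y) = f y + a * d y by rewrite subrK.
  by rewrite mulrDr !mulrA -!exprSr (addrC (_ * f y)) -addrA -mulrS.
have p_gt0 := prime_gt0 (pcharf_prime charLp).
rewrite expnSr exprM -/a -(prednK p_gt0) da prednK //.
by rewrite -mulr_natr (pcharf0 charLp) mulr0 addr0.
Qed.

Lemma separable_dif l : separable_element 1 l -> l \in dif_subfield L.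
Proof.
move=> sep_l; apply/dif_subfieldP/dif_eltP=> d [i Dd] x.
(* Separability puts [l] in K(l^(p^(i+1))), whose generator is the p-th power of l^(p^i), with which
   [d] commutes. *)
rewrite (pcharf_p_separable _ _ i charLp) in sep_l.
have [q ->] := Fadjoin1_polyP sep_l.
have Dz n y : d (l ^+ (p ^ i) ^+ n * y) = l ^+ (p ^ i) ^+ n * d y.
  elim: n => [|n IHn]; first by rewrite !mul1r.
  by rewrite exprS -!mulrA diffop_commute_expp ?IHn.
elim/poly_ind: q x => [|q c IHq] x.
  by rewrite map_poly0 horner0 !mul0r linear0.
rewrite rmorphD rmorphM /= map_polyX map_polyC /= hornerMXaddC !mulrDl.
rewrite linearD /= -!mulrA IHq expnSr exprM Dz.
by rewrite -!scalerAl !mul1r linearZ.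
Qed.

(** Some x^n with n a power of p is separable over [K]. *)
Lemma purely_inseparable_dif x : purely_inseparable_element (dif_subfield L) x.
Proof.
have [n /andP[charLn sep_xn]] := separable_exponent_pchar 1 x.
by apply/purely_inseparable_elementP_pchar; exists n; rewrite ?separable_dif.
Qed.
End DiffOp.

(** * Orbits under G(L/K) and Artin's argument *)

Section Conjugates.
Variables (K : fieldType) (L : fieldExtType K).
Local Notation G := (autg (1%VS : {vspace L})).
Implicit Types (g : G) (E : {subfield L}).

(** The orbit is finite because it consists of roots of the minimal polynomial of [x] over [K],
    whose coefficients every [g] fixes. *)
Lemma conjugates_exist (x : L) :
  exists2 r : seq L, uniq r & forall b, b \in r <-> exists g, b = g x.
Proof.
apply: (@finite_roots_subset _ (minPoly 1 x)) => [|_ [g ->]].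
  exact/monic_neq0/monic_minPoly.
have := root_minPoly 1 x; rewrite -(fmorph_root g) /=.
have /polyOver1P[q ->] := minPolyOver 1 x.
congr (root _ _); apply/polyP=> i; rewrite !coef_map /= linearZ /=.
by rewrite rmorph1.
Qed.

Section MinPoly.
Variables (E : {subfield L}) (x : L) (r : seq L).
Hypotheses (stE : forall g y, y \in E -> g y \in E) (Ex : x \in E).
Hypotheses (Ur : uniq r) (rP : forall b, b \in r <-> exists g, b = g x).
Local Notation F := (fixed_subfield E).

Lemma conjugates_sub : all [in E] r.
Proof. by apply/allP=> b /rP[g ->]; apply: stE. Qed.

Lemma fixed_subfield_le : (F <= E)%VS.
Proof. by apply/subvP=> y /fixed_subfieldP[]. Qed.

Lemma map_conjugates g : perm_eq (map g r) r.
Proof.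
have Ugr : uniq (map g r) by rewrite map_inj_uniq //; apply: fmorph_inj.
have sgr : {subset map g r <= r}.
  move=> _ /mapP[_ /rP[h ->] ->]; apply/rP; exists (autg_mul g h).
  by rewrite comp_lfunE.
apply: uniq_perm => //.
by have [|_] := uniq_min_size Ugr sgr; rewrite ?size_map.
Qed.

Lemma map_poly_fixed g (q : {poly L}) : q \is a polyOver F -> map_poly g q = q.
Proof.
move/polyOverP=> Fq; apply/polyP=> i; rewrite coef_map /=.
by case/fixed_subfieldP: (Fq i).
Qed.

(** Each [g] permutes the factors, so the product has coefficients in [F] and the minimal polynomial
    divides it. Conversely, all conjugates are roots of the minimal polynomial, and those listed in
    [r] are distinct. *)
Lemma minPoly_conjugates : minPoly F x = \prod_(b <- r) ('X - b%:P).
Proof.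
set P := \prod_(b <- r) _.
have gP g : map_poly g P = P.
  rewrite -[RHS](perm_big _ (map_conjugates g)) big_map rmorph_prod /=.
  by apply: eq_bigr => b _; rewrite map_polyXsubC.
have EP : P \is a polyOver E.
  rewrite /P big_seq rpred_prod // => b /(allP conjugates_sub).
  by rewrite polyOverXsubC.
have FP : P \is a polyOver F.
  apply/polyOverP=> i; apply/fixed_subfieldP; split=> [|g].
    exact/polyOverP.
  by rewrite -[in RHS](gP g) coef_map.
have Px : root P x.
  rewrite root_prod_XsubC; apply/rP; exists (autg_one _).
  by rewrite id_lfunE.
have Pmon : P \is monic by apply: monic_prod_XsubC.
apply/eqP; rewrite -eqp_monic ?monic_minPoly // /eqp minPoly_dvdp //=.
apply: uniq_roots_dvdp; last by rewrite uniq_rootsE.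
apply/allP=> _ /rP[g ->].
by rewrite -(map_poly_fixed g (minPolyOver F x)) fmorph_root root_minPoly.
Qed.

Lemma separable_fixed_subfield : separable_element F x.
Proof.
by rewrite /separable_element minPoly_conjugates separable_prod_XsubC.
Qed.

End MinPoly.

(** Used both for [E] = L_dif and for [E] = L. *)
Lemma galois_ext_fixed_subfield E :
  (forall g y, y \in E -> g y \in E) -> galois_ext (fixed_subfield E) E.
Proof.
move=> stE; split; first exact: fixed_subfield_le.
  apply/separableP=> y Ey; have [r Ur rP] := conjugates_exist y.
  exact: separable_fixed_subfield Ur rP.
move=> y Ey; have [r Ur rP] := conjugates_exist y.
exists r; first exact: conjugates_sub rP.
exact: minPoly_conjugates Ur rP.
Qed.
End Conjugates.

(** * Tensor product with a simple extension N = F(t) *)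

Section TensorSimple.
Variables (K : fieldType) (L : fieldExtType K) (F M N : {subfield L}) (t : L).
Hypotheses (sFM : (F <= M)%VS) (sFN : (F <= N)%VS).
Local Notation T := (tensor F M N).
Local Notation pure := (@pure_tensor K L F M N).
Local Notation gen m n :=
  ([freeg [:: (1, (m, n))]] : {freeg (subvs_of M * subvs_of N)%type / int}).

Lemma pure_tensor_relator z : tensor_relator F z -> (\pi_T z)%qT = 0.
Proof.
move=> rz; rewrite -[0](raddf0 (\pi_T)%qT); apply/eqP.
by rewrite -Quotient.idealrBE subr0; apply/asboolP=> S _; apply.
Qed.

Lemma pure_tensorDl m1 m2 n : pure (m1 + m2) n = pure m1 n + pure m2 n.
Proof.
have /eqP := pure_tensor_relator (TensorAddl F m1 m2 n).
by rewrite raddfB raddfD subr_eq0 => /eqP.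
Qed.

Lemma pure_tensorDr m n1 n2 : pure m (n1 + n2) = pure m n1 + pure m n2.
Proof.
have /eqP := pure_tensor_relator (TensorAddr F m n1 n2).
by rewrite raddfB raddfD subr_eq0 => /eqP.
Qed.

Lemma pure_tensor_scale (a : subvs_of F) m n :
  pure (vsproj M (vsval a * vsval m)) n = pure m (vsproj N (vsval a * vsval n)).
Proof.
have /eqP := pure_tensor_relator (TensorScale a m n).
by rewrite raddfB subr_eq0 => /eqP.
Qed.

Hypotheses (defN : N = <<F; t>>%VS :> {vspace L}).
Hypotheses (defL : {:L}%VS = <<M; t>>%VS).
Hypothesis eq_deg : adjoin_degree F t = adjoin_degree M t.
Local Notation d := (adjoin_degree M t).

Let Nt : t \in N. Proof. by rewrite memvE defN -memvE memv_adjoin. Qed.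
Let tN i : subvs_of N := vsproj N (t ^+ i).
Let tNE i : vsval (tN i) = t ^+ i. Proof. by rewrite vsprojK ?rpredX. Qed.
(** Candidate normal forms: the t^i with i < d form a basis of [N] over [F], so they should generate
    the tensor product over [M]. *)
Let normal (m : 'I_d -> subvs_of M) : T := \sum_i pure (m i) (tN i).

(** Expand the right factor of a pure tensor in powers of [t] and move the coefficients, which lie
    in [F], to the left factor. Normal forms are closed under sums and integer multiples. *)
Let normal_ex (s : T) : exists m, s = normal m.
Proof.
have n0 : 0 = normal (fun=> 0).
  rewrite /normal big1 // => i _.
  by apply: (addrI (pure 0 (tN i))); rewrite -pure_tensorDl !addr0.
have nD m1 m2 : normal m1 + normal m2 = normal (fun i => m1 i + m2 i).
  by rewrite -big_split; apply: eq_bigr => i _; rewrite pure_tensorDl.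
have nN m : - normal m = normal (fun i => - m i).
  apply: (addrI (normal m)); rewrite subrr nD n0; congr normal.
  by apply: funext => i; rewrite subrr.
have ngen m n : exists m', pure m n = normal m'.
  pose q := Fadjoin_poly F t (vsval n).
  pose a i : subvs_of F := vsproj F q`_i.
  have aE i : vsval (a i) = q`_i.
    by rewrite vsprojK // (polyOverP (Fadjoin_polyOver F t _)).
  have -> : n = \sum_(i < d) vsproj N (vsval (a i) * vsval (tN i)).
    apply: subvs_inj; rewrite linear_sum /=.
    rewrite -{1}(@Fadjoin_poly_eq _ _ F t (vsval n)) -?defN ?subvsP //.
    (* The expansion has at most [F(t):F] terms, while [d] is the degree over [M]; [eq_deg]
       reconciles the two. *)
    rewrite (@horner_coef_wide _ d) -/q -?eq_deg ?size_Fadjoin_poly //.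
    apply: eq_bigr => i _; rewrite vsprojK aE tNE // memvM ?rpredX //.
    by rewrite (subvP sFN) // -aE subvsP.
  exists (fun i => vsproj M (vsval (a i) * vsval m)).
  rewrite (big_morph _ (pure_tensorDr m) (id1 := 0)).
    by apply: eq_bigr => i _; rewrite pure_tensor_scale.
  by apply: (addrI (pure m 0)); rewrite -pure_tensorDr !addr0.
have nMn m k : exists m', normal m *+ k = normal m'.
  elim: k => [|k [m' IHk]]; first by exists (fun=> 0).
  by eexists; rewrite mulrS IHk nD.
rewrite -[s]reprK -[repr s]freeg_sumE raddf_sum /=.
apply: (big_ind (fun u => exists m, u = normal m)) => [|_ _ [m1 ->] [m2 ->]|].
- by exists (fun=> 0).
- by eexists; apply: nD.
move=> [m n] _; set c := coeff _ _.
have -> : [freeg [:: (c, (m, n))]] = gen m n *~ c.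
  by rewrite freegU_mulz intz.
have [m' Dm'] := ngen m n; rewrite raddfMz [X in X *~ _]Dm'.
case: c => k; first by rewrite -pmulrn; apply: nMn.
(* [Negz k] stands for -(k+1), hence the multiple [k.+1]. *)
by have [m2 Em2] := nMn m' k.+1; eexists; rewrite NegzE -nmulrn Em2 nN.
Qed.

Let tensor_mul_normal m :
  tensor_mul (normal m) = (\poly_(i < d) vsval (m (inord i))).[t].
Proof.
have mul0 : @tensor_mul K L F M N 0 = 0.
  have E := tensor_mulD sFM sFN 0 0; rewrite addr0 in E.
  by apply: (addrI (@tensor_mul K L F M N 0)); rewrite -E addr0.
rewrite (big_morph _ (tensor_mulD sFM sFN) mul0) horner_poly.
by apply: eq_bigr => i _; rewrite tensor_mulU // tNE inord_val.
Qed.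

(** The inverse sends an element of L = M(t) to the normal form built from its coordinates in the
    powers of [t]; uniqueness of these coordinates gives the other cancellation. *)
Lemma simple_tensor_product : is_tensor_product F M N.
Proof.
split=> //; exists (fun x =>
  normal (fun i => vsproj M (Fadjoin_poly M t x)`_i)) => [s|x]; last first.
  rewrite tensor_mul_normal -[RHS](@Fadjoin_poly_eq _ _ M t) -?defL ?memvf //.
  congr _.[t]; apply/polyP=> i; rewrite coef_poly; case: ltnP => [lt_i|le_i].
    rewrite inordK // vsprojK //.
    exact: (polyOverP (Fadjoin_polyOver M t x)).
  by rewrite nth_default // (leq_trans (size_Fadjoin_poly M t x)).
have [m ->] := normal_ex s; congr normal; apply: funext => i.
rewrite tensor_mul_normal (@Fadjoin_poly_unique _ _ M t _ _ _ _ erefl).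
- by rewrite coef_poly ltn_ord inord_val vsvalK.
- apply/polyOverP=> j; rewrite coef_poly.
  by case: ifP => _; rewrite ?subvsP ?mem0v.
exact: size_poly.
Qed.

End TensorSimple.

Lemma pchar_nat_expI (R : idomainType) n (x y : R) :
  [pchar R].-nat n -> x ^+ n = y ^+ n -> x = y.
Proof.
move=> charRn exy; apply/eqP; rewrite -subr_eq0.
have: (x - y) ^+ n == 0.
  (* Adding y^n turns the claim into additivity of the n-th power on (x - y) + y, with no sign
     (-1)^n to compute. *)
  by apply/eqP/(addIr (y ^+ n)); rewrite -exprDn_pchar // subrK add0r.
by rewrite expf_eq0 => /andP[].
Qed.

(** [h] acts on the type [subvs_of E], whereas polynomials are taken over [L]; evaluation is
    transported because [h] fixes the coefficients. *)
Lemma sub_autg_horner (K : fieldType) (L : fieldExtType K) (F E : {subfield L})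
    (h : sub_autg E F) (q : {poly L}) (x y : subvs_of E) :
    (F <= E)%VS -> q \is a polyOver F -> vsval y = q.[vsval x] ->
  vsval (h y) = q.[vsval (h x)].
Proof.
move=> sFE Fq; have /polyOver_subvs[q' Dq] := polyOverS (subvP sFE) Fq.
rewrite Dq !horner_map /= => /subvs_inj->; rewrite -horner_map.
congr (vsval _.[_]).
apply/polyP=> i; rewrite coef_map /= autg_fix // mem_base_in.
by have := polyOverP Fq i; rewrite Dq coef_map.
Qed.

(** * Restriction from G(L/K) to L_dif, through a primitive element *)

Section MainProof.
Variables (K : fieldType) (p : nat) (charKp : p \in [pchar K]).
Variable L : fieldExtType K.
Local Notation G := (autg (1%VS : {vspace L})).
Local Notation Ldif := (dif_subfield L).
Local Notation LG := (inv_subfield L).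
Local Notation LGdif := (inv_dif_subfield L).
Local Notation t := (separable_generator LGdif Ldif).

Let charLp : p \in [pchar L]. Proof. exact: (rmorph_pchar (in_alg L)). Qed.

Lemma fixed_dif_subfield : fixed_subfield Ldif = LGdif.
Proof.
apply/val_inj/vspaceP=> x /=; rewrite memv_cap andbC.
apply/idP/idP=> [/fixed_subfieldP[-> Gx]|/andP[Dx /fixed_subfieldP[_ Gx]]].
  by apply/fixed_subfieldP; rewrite memvf.
exact/fixed_subfieldP.
Qed.

Lemma galois_ext_dif : galois_ext LGdif Ldif.
Proof.
rewrite -fixed_dif_subfield; apply: galois_ext_fixed_subfield => g y.
exact: dif_subfield_stable.
Qed.

Lemma dif_simple : Ldif = <<LGdif; t>>%VS :> {vspace L}.
Proof.
have [sFE sepE _] := galois_ext_dif.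
exact: eq_adjoin_separable_generator.
Qed.

Lemma inv_simple : {:L}%VS = <<LG; t>>%VS.
Proof.
apply/eqP; rewrite eqEsubv subvf andbT; apply/subvP=> x _.
have [_ /separableP sepL _] :=
  @galois_ext_fixed_subfield K L {:L}%AS (fun _ _ _ => memvf _).
rewrite -(separable_inseparable_element <<LG; t>>%AS).
rewrite (separable_elementS (subv_adjoin _ _) (sepL x (memvf x))) /=.
(* Pure inseparability over [Ldif] passes to LG(t), which contains [Ldif] = LGdif(t). *)
apply: sub_inseparable (purely_inseparable_dif charLp x).
by rewrite [X in (X <= _)%VS]dif_simple adjoinSl ?capvSl.
Qed.

(** The orbit of [t] does not depend on the ambient stable field, so Artin's argument in [Ldif] and
    in [L] yields the same product. *)
Lemma minPoly_dif_inv : exists2 r : seq L,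
    forall b, b \in r <-> exists g : G, b = g t
  & minPoly LGdif t = \prod_(b <- r) ('X - b%:P)
    /\ minPoly LG t = minPoly LGdif t.
Proof.
have [r Ur rP] := conjugates_exist t; exists r => //.
have E : minPoly LGdif t = \prod_(b <- r) ('X - b%:P).
  have := minPoly_conjugates (@dif_subfield_stable K L) _ Ur rP.
  by rewrite fixed_dif_subfield; apply; apply: separable_generator_mem.
rewrite E; split=> //.
by apply: (@minPoly_conjugates K L {:L}%AS _ _ _ _ Ur rP) => *; apply: memvf.
Qed.

Lemma adjoin_degree_dif_inv : adjoin_degree LGdif t = adjoin_degree LG t.
Proof.
have [r _ [_ E]] := minPoly_dif_inv.
by apply: succn_inj; rewrite -!size_minPoly E.
Qed.

Lemma res_dif_morph : {morph @res_dif K L : g h / (g * h)%g}.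
Proof.
move=> g h; apply/autg_eqP=> x; apply: subvs_inj.
by rewrite res_difE !comp_lfunE !res_difE.
Qed.

Lemma res_dif_inj : injective (@res_dif K L).
Proof.
move=> g h eq_gh; apply/autg_eqP=> x.
have /purely_inseparable_elementP_pchar[n charLn Dxn] :=
  purely_inseparable_dif charLp x.
apply: (pchar_nat_expI charLn); rewrite -!rmorphXn /=.
by have := res_difE g (Subvs Dxn); rewrite eq_gh res_difE.
Qed.

Lemma res_dif_surj h : exists g, @res_dif K L g = h.
Proof.
have sFE : (LGdif <= Ldif)%VS by apply: capvSr.
have Dt : t \in Ldif by apply: separable_generator_mem.
have [r rP [Dr _]] := minPoly_dif_inv.
have Fm := minPolyOver LGdif t.
(* [h] maps [t] to a root of the same minimal polynomial: the evaluation lemma is applied with value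
   [0]. *)
have /rP[g ht] : vsval (h (Subvs Dt)) \in r.
  rewrite -root_prod_XsubC -Dr /root -(@sub_autg_horner _ _ _ _ h _ _ 0 sFE Fm).
    by rewrite !linear0.
  by rewrite linear0 /= minPolyxx.
exists g; apply/autg_eqP=> x; apply: subvs_inj; rewrite res_difE.
have Dx : vsval x \in <<LGdif; t>>%VS by rewrite -dif_simple subvsP.
have Fq := Fadjoin_polyOver LGdif t (vsval x).
rewrite (@sub_autg_horner _ _ _ _ h _ (Subvs Dt) x sFE Fq) ?ht; last first.
  by rewrite /= Fadjoin_poly_eq.
(* [g] also fixes the coefficients, so agreement at [t] extends to LGdif(t) = [Ldif]. *)
rewrite -{1}(Fadjoin_poly_eq Dx) -horner_map /=; congr _.[_].
apply/polyP=> i; rewrite coef_map /=.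
by have := polyOverP Fq i; rewrite memv_cap => /andP[/fixed_subfieldP[_ ->]].
Qed.

Lemma res_dif_bij : bijective (@res_dif K L).
Proof.
have resK h : res_dif (sval (cid (res_dif_surj h))) = h by case: cid.
by exists (fun h => sval (cid (res_dif_surj h))) => // g; apply: res_dif_inj.
Qed.
End MainProof.

Theorem proposition5p18 (K : fieldType) (p : nat) (charKp : p \in [pchar K])
    (L : fieldExtType K) :
  let Ldif := dif_subfield L in
  let LG := inv_subfield L in
  let LGdif := inv_dif_subfield L in
  [/\
      (* 1 *)
      (fixed_subfield Ldif = (LG :&: Ldif)%VS :> {vspace L})
        /\ ((LG :&: Ldif)%VS = LGdif :> {vspace L}),
      (* 2 *)
      {morph @res_dif K L : g h / (g * h)%g} /\ bijective (@res_dif K L),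
      (* 3 *)
      [/\ galois_ext LGdif Ldif,
          forall g : 'AEnd(L),
            (1%VS <= fixedSpace g)%VS = (LG <= fixedSpace g)%VS
        & forall h : sub_autg Ldif LGdif,
            exists! g : autg (1%VS : {vspace L}),
              forall x : subvs_of Ldif, g (vsval x) = vsval (h x)],
      (* 4 *)
      (\dim_LGdif Ldif = \dim_LG {:L})%N
    & (* 5 *)
      [/\ (\dim_LGdif LG = \dim_Ldif {:L})%N,
          forall g : autg Ldif, g = 1%g
        & forall g : sub_autg LG LGdif, g = 1%g]
      (* 6 *)
      /\ is_tensor_product LGdif LG Ldif
      /\ (\dim_LGdif {:L} = \dim_LGdif LG * \dim_LGdif Ldif)%N].
Proof.
move=> Ldif LG LGdif.
have charLp : p \in [pchar L] by apply: (rmorph_pchar (in_alg L)).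
have sFM : (LGdif <= LG)%VS by apply: capvSl.
have sFN : (LGdif <= Ldif)%VS by apply: capvSr.
have dimE : (\dim_LGdif Ldif = \dim_LG {:L})%N.
  (* Both degrees are the degree of the common generator [t]. *)
  rewrite (inv_simple charKp) [X in (\dim X %/ _)%N]dif_simple.
  by rewrite -!adjoin_degreeE adjoin_degree_dif_inv.
have insep x : exists2 n, [pchar L].-nat n & x ^+ n \in Ldif.
  exact/purely_inseparable_elementP_pchar/(purely_inseparable_dif charLp).
have dimF_gt0 : (0 < \dim LGdif)%N := adim_gt0 LGdif.
have dimM := dim_sup_field sFM.
have dimN := dim_sup_field sFN.
have dimL := dim_sup_field (subvf LG).
split=> //; last split; last split.
- by rewrite fixed_dif_subfield.
- by split; [apply: res_dif_morph | exact: (res_dif_bij charKp L)].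
- split=> [|g|h]; first exact: galois_ext_dif.
    (* Both sides are true: [g] is [K]-linear and fixes 1, and [LG] is fixed by definition. *)
    have sub1 : (1 <= fixedSpace g)%VS.
      by apply/fixedSpacesP=> _ /vlineP[k ->]; rewrite linearZ /= rmorph1.
    rewrite sub1; apply/esym/fixedSpacesP=> x /fixed_subfieldP[_ Gx].
    exact: (Gx (Autg sub1)).
  have [g Dh] := res_dif_surj h; exists g; split=> [x|g' Dg'].
    by rewrite -Dh res_difE.
  apply: (res_dif_inj charKp); rewrite Dh; apply/autg_eqP=> x.
  by apply: subvs_inj; rewrite res_difE Dg'.
- split.
  (* All dimensions become multiples of [\dim LGdif]; positivity of [\dim Ldif] licenses the
     cancellation in natural-number division. *)
  + have := adim_gt0 Ldif.
    rewrite dimL -dimE dimM dimN => dimN_gt0.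
    by rewrite mulnCA mulnK ?mulnK.
  + move=> g; apply/autg_eqP=> x; have [n charLn Dxn] := insep x.
    by apply: (pchar_nat_expI charLn); rewrite id_lfunE -rmorphXn /= autg_fix.
  move=> g; apply/autg_eqP=> x; rewrite id_lfunE; apply: subvs_inj.
  have [n charLn Dxn] := insep (vsval x).
  apply: (pchar_nat_expI charLn); rewrite -!rmorphXn /= autg_fix //.
  (* x^n lies in [Ldif], and in [LG] because [x] does, hence in [LGdif], which [g] fixes. *)
  by rewrite mem_base_in memv_cap subvsP rmorphXn.
- apply: simple_tensor_product sFM sFN (dif_simple L) (inv_simple charKp L) _.
  exact: adjoin_degree_dif_inv.
by rewrite dimL -dimE [X in (_ * X %/ _)%N]dimM mulnA mulnK // mulnC.
Qed.
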